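(* Let $X_1,X_2,\dots$ be i.i.d. generalised random variables on $\mathbb{R}$ with common pair $(T,\varphi)$, $T\in\mathcal{S}'(\mathbb{R})$, $\varphi\in\mathcal{S}(\mathbb{R})$, normalised by $\langle T,\varphi\rangle=1$, with weak cumulants ${}^{(\varphi)}\kappa_1\in\mathbb{R}$ and ${}^{(\varphi)}\kappa_2>0$. Let $S_n=X_1+\dots+X_n$ and $Z_n=(S_n-n\,{}^{(\varphi)}\kappa_1)/\sqrt{n\,{}^{(\varphi)}\kappa_2}$. Then $${}^{(\varphi)}\phi_{Z_n}(t)\to\exp\!\left(-\frac{t^2}{2}\right)\qquad\text{as }n\to\infty,\text{ for all }t\in\mathbb{R}.$$
   Context: $\mathcal{S}$, $\mathcal{S}'$ denote Schwartz functions and tempered distributions. The weak characteristic function of a pair $(T,\varphi)$ is ${}^{(\varphi)}\phi(t):=\langle T,e^{itx}\varphi(x)\rangle$, a smooth function of $t$; near $0$, ${}^{(\varphi)}K(t):=\log{}^{(\varphi)}\phi(t)$ (continuous branch with ${}^{(\varphi)}K(0)=0$), and the weak cumulants are ${}^{(\varphi)}\kappa_n:=i^{-n}\frac{d^n}{dt^n}{}^{(\varphi)}K(t)\big|_{t=0}$. Generalised random variables are specified by their pairs; i.i.d. means the joint representation of $X_1,\dots,X_n$ is the $n$-fold tensor product pair $(T^{\otimes n},\varphi^{\otimes n})$, so that the weak characteristic function of $S_n$ is ${}^{(\varphi)}\phi_{S_n}(t)=\bigl({}^{(\varphi)}\phi(t)\bigr)^n$. By the translation and scaling rules, the weak characteristic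 function of $Z_n$ is $${}^{(\varphi)}\phi_{Z_n}(t)=\exp\!\left(-it\frac{n\,{}^{(\varphi)}\kappa_1}{\sqrt{n\,{}^{(\varphi)}\kappa_2}}\right)\left({}^{(\varphi)}\phi\!\left(\frac{t}{\sqrt{n\,{}^{(\varphi)}\kappa_2}}\right)\right)^{n}.$$ *)

(* Defs.v *)
From Stdlib Require Import Reals.
From Coquelicot Require Import Coquelicot.

Open Scope R_scope.

Definition Cexp (z : C) : C :=
  (RtoC (exp (Re z)) * (cos (Im z), sin (Im z)))%C.

(** Derivatives of functions of a real variable with values in [C] are taken
    componentwise. *)
Definition CDerive_n (f : R -> C) (n : nat) (t : R) : C :=
  (Derive_n (fun s => Re (f s)) n t, Derive_n (fun s => Im (f s)) n t).

Definition Csmooth (f : R -> C) : Prop :=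
  forall (n : nat) (t : R),
    ex_derive_n (fun s => Re (f s)) n t /\ ex_derive_n (fun s => Im (f s)) n t.

(** sup_x |x|^k |f^(m)(x)|, possibly [p_infty]. *)
Definition schwartz_seminorm (k m : nat) (f : R -> C) : Rbar :=
  Lub_Rbar (fun y => exists x : R, y = Rabs x ^ k * Cmod (CDerive_n f m x)).

Definition schwartz (f : R -> C) : Prop :=
  Csmooth f /\ forall k m : nat, Rbar_lt (schwartz_seminorm k m f) p_infty.

(** A tempered distribution is represented by a functional on all functions
    [R -> C]; only its values on Schwartz functions are meaningful, and on these
    it is linear and continuous for the topology generated by the seminorms. *)
Definition tempered (T : (R -> C) -> C) : Prop :=
  (forall f g : R -> C, schwartz f -> schwartz g ->
     T (fun x => f x + g x)%C = (T f + T g)%C) /\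
  (forall (c : C) (f : R -> C), schwartz f ->
     T (fun x => c * f x)%C = (c * T f)%C) /\
  (forall f : R -> C, schwartz f ->
     forall eps : R, 0 < eps ->
     exists (N : nat) (delta : R), 0 < delta /\
       forall g : R -> C, schwartz g ->
         (forall k m : nat, (k <= N)%nat -> (m <= N)%nat ->
            Rbar_lt (schwartz_seminorm k m (fun x => g x - f x)%C) delta) ->
         Cmod (T g - T f) < eps).

(** Points of R^n are elements of Coquelicot's [Tn n R].  The tensor power acts
    by <T (x) U, f> = <T_x, <U_y, f(x,y)>>. *)
Fixpoint tensor_pow (T : (R -> C) -> C) (n : nat) : (Tn n R -> C) -> C :=
  match n return (Tn n R -> C) -> C with
  | O => fun f => f tt
  | S m => fun f => T (fun x => tensor_pow T m (fun y => f (x, y)))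
  end.

Fixpoint fun_tensor_pow (phi : R -> C) (n : nat) : Tn n R -> C :=
  match n return Tn n R -> C with
  | O => fun _ => RtoC 1
  | S m => fun v => (phi (fst v) * fun_tensor_pow phi m (snd v))%C
  end.

Fixpoint Tn_sum (n : nat) : Tn n R -> R :=
  match n return Tn n R -> R with
  | O => fun _ => 0
  | S m => fun v => fst v + Tn_sum m (snd v)
  end.

(** Weak characteristic function of the real function [g] of a generalised
    random element of [V] with pair [(T, phi)]: <T, e^{i t g} phi>. *)
Definition weak_cf_of {V : Type} (T : (V -> C) -> C) (phi : V -> C)
    (g : V -> R) (t : R) : C :=
  T (fun v => Cexp (Ci * RtoC (t * g v)) * phi v)%C.

Definition weak_cf (T : (R -> C) -> C) (phi : R -> C) : R -> C :=
  weak_cf_of T phi (fun x => x).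

(** [K] is, near 0, the continuous branch of [log f] with [K 0 = 0]; its values
    away from 0 are irrelevant. *)
Definition is_log_branch (f K : R -> C) : Prop :=
  K 0 = RtoC 0 /\
  locally 0 (fun t => continuous K t /\ Cexp (K t) = f t).

(** i^{-n} K^(n)(0), for [K] the logarithm of the weak characteristic function. *)
Definition weak_cumulant (K : R -> C) (n : nat) : C :=
  (/ (Ci ^ n) * CDerive_n K n 0)%C.

(** Weak characteristic function of Z_n = (X_1 + ... + X_n - n k1) / sqrt (n k2),
    where X_1, ..., X_n are i.i.d. with common pair [(T, phi)]: their joint pair
    is the n-fold tensor power. *)
Definition weak_cf_Z (T : (R -> C) -> C) (phi : R -> C) (k1 k2 : R) (n : nat)
    : R -> C :=
  weak_cf_of (tensor_pow T n) (fun_tensor_pow phi n)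
    (fun v => (Tn_sum n v - INR n * k1) / sqrt (INR n * k2)).

(* Main.v *)
Require Import Defs.
From Stdlib Require Import Reals Lra Lia FunctionalExtensionality.
From Coquelicot Require Import Coquelicot.

(** If [g] is Schwartz then [(e^(ihx) - 1) / h * g] tends to [i x g] in every
    Schwartz seminorm as [h -> 0], so [t |-> <T, e^(itx) g>] is differentiable with
    derivative [<T, e^(itx) i x g>]; iterating, the weak characteristic function
    [f = u + i v] is twice differentiable.  Near [0] the continuous branch of its
    logarithm has to be [K = ln (u^2 + v^2) / 2 + i atan (v / u)], hence
    [K s = i k1 s - k2 s^2 / 2 + o(s^2)].  Linearity of [T] factorises the tensor
    power, so with [s = t / sqrt (n k2)] the weak characteristic function of [Z_n]
    at [t] equals [exp (n K s - i n k1 s)], whose exponent tends to [- t^2 / 2]. *)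

(** * Products with rapidly decreasing functions *)

(** Componentwise, to agree with [CDerive_n] and to give access to the real differentiation
    rules. *)
Definition is_Cderive (f : R -> C) (x : R) (l : C) : Prop :=
  is_derive (fun s => Re (f s)) x (Re l) /\
  is_derive (fun s => Im (f s)) x (Im l).

Lemma is_Cderive_plus (f g : R -> C) (x : R) (l m : C) :
  is_Cderive f x l -> is_Cderive g x m ->
  is_Cderive (fun s => f s + g s)%C x (l + m)%C.
Proof.
  intros [Hf1 Hf2] [Hg1 Hg2]; split.
  - exact (is_derive_plus _ _ _ _ _ Hf1 Hg1).
  - exact (is_derive_plus _ _ _ _ _ Hf2 Hg2).
Qed.

Lemma is_Cderive_mult (f g : R -> C) (x : R) (l m : C) :
  is_Cderive f x l -> is_Cderive g x m ->
  is_Cderive (fun s => f s * g s)%C x (l * g x + f x * m)%C.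
Proof.
  intros [Hf1 Hf2] [Hg1 Hg2]; split.
  - refine (eq_ind _ (fun r => is_derive _ x r) (is_derive_minus
      (fun s => Re (f s) * Re (g s)) (fun s => Im (f s) * Im (g s)) _ _ _
      (is_derive_mult _ _ _ _ _ Hf1 Hg1 Rmult_comm)
      (is_derive_mult _ _ _ _ _ Hf2 Hg2 Rmult_comm)) _ _).
    unfold minus, plus, opp, mult, Re, Im; simpl; ring.
  - refine (eq_ind _ (fun r => is_derive _ x r) (is_derive_plus
      (fun s => Re (f s) * Im (g s)) (fun s => Im (f s) * Re (g s)) _ _ _
      (is_derive_mult _ _ _ _ _ Hf1 Hg2 Rmult_comm)
      (is_derive_mult _ _ _ _ _ Hf2 Hg1 Rmult_comm)) _ _).
    unfold plus, mult, Re, Im; simpl; ring.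
Qed.

Lemma is_Cderive_const (c : C) (x : R) : is_Cderive (fun _ => c) x (RtoC 0).
Proof. split; apply @is_derive_const. Qed.

(** Carrying all derivatives explicitly replaces any computation with [Derive_n]: the next lemma
    identifies [F m] with [CDerive_n (F 0) m]. *)
Definition derivative_seq (F : nat -> R -> C) : Prop :=
  forall m x, is_Cderive (F m) x (F (S m) x).

Lemma CDerive_n_derivative_seq (F : nat -> R -> C) (m : nat) (x : R) :
  derivative_seq F -> CDerive_n (F 0%nat) m x = F m x.
Proof.
  intros HF. unfold CDerive_n.
  assert (H : forall n y, Derive_n (fun s => Re (F 0%nat s)) n y = Re (F n y) /\
                          Derive_n (fun s => Im (F 0%nat s)) n y = Im (F n y)).
  { induction n as [|n IH]; intros y; [split; reflexivity|].
    destruct (HF n y) as [H1 H2]. simpl. split.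
    - rewrite (Derive_ext _ (fun s => Re (F n s)) y (fun s => proj1 (IH s))).
      now apply is_derive_unique.
    - rewrite (Derive_ext _ (fun s => Im (F n s)) y (fun s => proj2 (IH s))).
      now apply is_derive_unique. }
  destruct (H m x) as [-> ->]. now destruct (F m x).
Qed.

Lemma derivative_seq_Csmooth (F : nat -> R -> C) :
  derivative_seq F -> Csmooth (F 0%nat).
Proof.
  intros HF [|n] t; [split; exact I|].
  assert (E : forall s, CDerive_n (F 0%nat) n s = F n s)
    by (intro s; now apply CDerive_n_derivative_seq).
  destruct (HF n t) as [H1 H2]. simpl. split.
  - apply (ex_derive_ext (fun s => Re (F n s))).
    + intro s. now rewrite <- E.
    + eexists; exact H1.
  - apply (ex_derive_ext (fun s => Im (F n s))).
    + intro s. now rewrite <- E.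
    + eexists; exact H2.
Qed.

Lemma CDerive_n_0 (f : R -> C) (x : R) : CDerive_n f 0 x = f x.
Proof. unfold CDerive_n; simpl. now destruct (f x). Qed.

Lemma Csmooth_derivative_seq (f : R -> C) :
  Csmooth f -> derivative_seq (CDerive_n f).
Proof.
  intros Hf m x. destruct (Hf (S m) x) as [H1 H2].
  split; simpl; now apply Derive_correct.
Qed.

Definition rapidly_decreasing (F : nat -> R -> C) : Prop :=
  forall k m, exists B, forall x, Rabs x ^ k * Cmod (F m x) <= B.

Lemma schwartz_seminorm_le (k m : nat) (f : R -> C) (B : R) :
  (forall x, Rabs x ^ k * Cmod (CDerive_n f m x) <= B) ->
  Rbar_le (schwartz_seminorm k m f) B.
Proof.
  intros H. unfold schwartz_seminorm.
  match goal with |- Rbar_le (Lub_Rbar ?E) _ =>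
    destruct (Lub_Rbar_correct E) as [_ HL] end.
  apply HL. intros y [x ->]. apply H.
Qed.

Lemma derivative_seq_schwartz (F : nat -> R -> C) :
  derivative_seq F -> rapidly_decreasing F -> schwartz (F 0%nat).
Proof.
  intros HF HB. split; [now apply derivative_seq_Csmooth|].
  intros k m. destruct (HB k m) as [B H].
  eapply Rbar_le_lt_trans.
  - apply (schwartz_seminorm_le k m _ B). intros x.
    rewrite CDerive_n_derivative_seq by exact HF. apply H.
  - exact I.
Qed.

Lemma schwartz_rapidly_decreasing (f : R -> C) :
  schwartz f -> rapidly_decreasing (CDerive_n f).
Proof.
  intros [_ Hf] k m. specialize (Hf k m). unfold schwartz_seminorm in Hf.
  match type of Hf with Rbar_lt (Lub_Rbar ?E) _ =>
    destruct (Lub_Rbar_correct E) as [HU _] end.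
  match type of Hf with Rbar_lt ?L _ => destruct L as [B| |] end.
  - exists B. intros x. apply HU. now exists x.
  - easy.
  (* The supremum is not [m_infty], because the set contains the value at 0. *)
  - exfalso. apply (HU (Rabs 0 ^ k * Cmod (CDerive_n f m 0))). now exists 0.
Qed.

(** For sequences of derivatives this is the [m]-th derivative of the product [A 0 * G 0]. It is
    kept as an unexpanded sum of [2 ^ m] terms, so no binomial coefficients occur. *)
Fixpoint leibniz (m : nat) (A G : nat -> R -> C) (x : R) : C :=
  match m with
  | O => A 0%nat x * G 0%nat x
  | S m' => leibniz m' (fun j => A (S j)) G x + leibniz m' A (fun j => G (S j)) x
  end%C.

Lemma derivative_seq_leibniz (A G : nat -> R -> C) :
  derivative_seq A -> derivative_seq G ->
  derivative_seq (fun m => leibniz m A G).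
Proof.
  intros HA HG m. revert A G HA HG.
  induction m as [|m IH]; intros A G HA HG x.
  - apply is_Cderive_mult; [apply HA | apply HG].
  - apply is_Cderive_plus; apply IH; trivial; intros j; [apply HA | apply HG].
Qed.

(* The constant [c] is uniform in the multiplier [A] and in its size [w]. *)
Lemma leibniz_bound (m k : nat) (b : nat -> R) (G : nat -> R -> C) :
  rapidly_decreasing G ->
  exists c, 0 <= c /\ forall (w : R) (A : nat -> R -> C), 0 <= w ->
    (forall j x, Cmod (A j x) <= w * b j * (1 + x ^ 2)) ->
    forall x, Rabs x ^ k * Cmod (leibniz m A G x) <= w * c.
Proof.
  revert b G. induction m as [|m IH]; intros b G HG.
  (* The factor [1 + x ^ 2] of the bound on [A] is absorbed by two further powers of [Rabs x] in the
     decay of [G]. *)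
  - destruct (HG k 0%nat) as [B1 H1]. destruct (HG (k + 2)%nat 0%nat) as [B2 H2].
    exists (Rabs (b 0%nat) * (Rabs B1 + Rabs B2)). split.
    { apply Rmult_le_pos; [|apply Rplus_le_le_0_compat]; apply Rabs_pos. }
    intros w A Hw HA x. simpl. rewrite Cmod_mult.
    specialize (HA 0%nat x). specialize (H1 x). specialize (H2 x).
    rewrite pow_add, pow2_abs in H2.
    assert (Hp : 0 <= Rabs x ^ k) by apply pow_le, Rabs_pos.
    set (p := Rabs x ^ k) in *. set (a := Cmod (A 0%nat x)) in *.
    assert (Hg : 0 <= Cmod (G 0%nat x)) by apply Cmod_ge_0.
    set (g := Cmod (G 0%nat x)) in *.
    assert (Hb : b 0%nat <= Rabs (b 0%nat)) by apply RRle_abs.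
    assert (HB1 : B1 <= Rabs B1) by apply RRle_abs.
    assert (HB2 : B2 <= Rabs B2) by apply RRle_abs.
    assert (Hx : 0 <= x ^ 2) by apply pow2_ge_0.
    assert (Hpg : 0 <= p * g) by now apply Rmult_le_pos.
    apply Rle_trans with ((p * g) * (w * Rabs (b 0%nat) * (1 + x ^ 2))).
    + replace (p * (a * g)) with ((p * g) * a) by ring.
      apply Rmult_le_compat_l; [exact Hpg|]. eapply Rle_trans; [exact HA|].
      apply Rmult_le_compat_r; [lra|]. now apply Rmult_le_compat_l.
    + replace (p * g * (w * Rabs (b 0%nat) * (1 + x ^ 2)))
        with ((w * Rabs (b 0%nat)) * (p * g + p * x ^ 2 * g)) by ring.
      rewrite <- Rmult_assoc. apply Rmult_le_compat_l; [|lra].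
      apply Rmult_le_pos; [exact Hw | apply Rabs_pos].
  - destruct (IH (fun j => b (S j)) G HG) as (c1 & Hc1 & H1).
    destruct (IH b (fun j => G (S j))) as (c2 & Hc2 & H2).
    { intros k' m'. apply HG. }
    exists (c1 + c2). split; [lra|]. intros w A Hw HA x.
    specialize (H1 w (fun j => A (S j)) Hw (fun j => HA (S j)) x).
    specialize (H2 w A Hw HA x). simpl.
    assert (Hp : 0 <= Rabs x ^ k) by apply pow_le, Rabs_pos.
    pose proof (Rmult_le_compat_l _ _ _ Hp (Cmod_triangle
      (leibniz m (fun j => A (S j)) G x) (leibniz m A (fun j => G (S j)) x))).
    lra.
Qed.

(** Quadratic growth of every derivative of the multiplier covers the three cases that occur:
    constants, [Ci * x] and [cis (t * x)]. *)
Lemma schwartz_mult (A : nat -> R -> C) (b : nat -> R) (g : R -> C) :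
  derivative_seq A -> (forall j x, Cmod (A j x) <= b j * (1 + x ^ 2)) ->
  schwartz g -> schwartz (fun x => A 0%nat x * g x)%C.
Proof.
  intros HA Hb Hg.
  replace (fun x => A 0%nat x * g x)%C with (leibniz 0 A (CDerive_n g)).
  2: { apply functional_extensionality; intro x. simpl. now rewrite CDerive_n_0. }
  apply (derivative_seq_schwartz (fun m => leibniz m A (CDerive_n g))).
  - apply derivative_seq_leibniz; [exact HA | now apply Csmooth_derivative_seq, Hg].
  - intros k m.
    destruct (leibniz_bound m k b _ (schwartz_rapidly_decreasing g Hg))
      as (c & _ & H).
    exists (1 * c). apply H; [lra|]. intros j x. rewrite Rmult_1_l. apply Hb.
Qed.

(** * Elementary estimates for e^(iy) *)

Lemma Cmod_le_Re_Im (z : C) : Cmod z <= Rabs (Re z) + Rabs (Im z).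
Proof.
  destruct z as [a b]. unfold Cmod; simpl.
  apply Rsqr_incr_0_var.
  - rewrite Rsqr_sqrt by nra. unfold Rsqr.
    pose proof (Rabs_pos a). pose proof (Rabs_pos b).
    pose proof (pow2_abs a). pose proof (pow2_abs b). nra.
  - pose proof (Rabs_pos a). pose proof (Rabs_pos b). lra.
Qed.

(** This form lets the kernel in [weak_cf_of] be folded into [cis]. *)
Definition cis (y : R) : C := Cexp (Ci * RtoC y)%C.

Lemma cis_eq (y : R) : cis y = (cos y, sin y).
Proof.
  unfold cis, Cexp, Ci, RtoC, Cmult, Re, Im; simpl.
  replace (0 * y - 1 * 0) with 0 by ring.
  replace (0 * 0 + 1 * y) with y by ring.
  rewrite exp_0. f_equal; ring.
Qed.

Lemma cis_0 : cis 0 = RtoC 1.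
Proof. now rewrite cis_eq, cos_0, sin_0. Qed.

Lemma cis_plus (a b : R) : cis (a + b) = (cis a * cis b)%C.
Proof.
  rewrite !cis_eq, cos_plus, sin_plus. unfold Cmult; simpl. f_equal; ring.
Qed.

Lemma Cmod_cis (y : R) : Cmod (cis y) = 1.
Proof.
  rewrite cis_eq. unfold Cmod; simpl.
  replace (cos y * (cos y * 1) + sin y * (sin y * 1)) with 1.
  - apply sqrt_1.
  - pose proof (sin2_cos2 y) as H. unfold Rsqr in H. lra.
Qed.

Lemma is_Cderive_cis (t x : R) :
  is_Cderive (fun x => cis (t * x)) x (Ci * RtoC t * cis (t * x))%C.
Proof.
  split.
  - apply (is_derive_ext (fun x => cos (t * x))).
    + intro s. now rewrite cis_eq.
    + rewrite cis_eq. unfold Cmult, Re; simpl. auto_derive; [trivial | ring].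
  - apply (is_derive_ext (fun x => sin (t * x))).
    + intro s. now rewrite cis_eq.
    + rewrite cis_eq. unfold Cmult, Im; simpl. auto_derive; [trivial | ring].
Qed.

Lemma cos_sub_1_bound (y : R) : Rabs (cos y - 1) <= Rabs y.
Proof.
  destruct (MVT_gen cos 0 y (fun z => - sin z)) as (c & _ & H).
  - intros x _. apply is_derive_cos.
  - intros x _. apply continuity_cos.
  - rewrite cos_0 in H. rewrite H, Rminus_0_r, Rabs_mult, Rabs_Ropp.
    rewrite <- (Rmult_1_l (Rabs y)) at 2.
    apply Rmult_le_compat_r; [apply Rabs_pos|].
    apply Rabs_le, SIN_bound.
Qed.

Lemma sin_bound_abs (y : R) : Rabs (sin y) <= Rabs y.
Proof.
  destruct (MVT_gen sin 0 y cos) as (c & _ & H).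
  - intros x _. apply is_derive_sin.
  - intros x _. apply continuity_sin.
  - rewrite sin_0, !Rminus_0_r in H. rewrite H, Rabs_mult.
    rewrite <- (Rmult_1_l (Rabs y)) at 2.
    apply Rmult_le_compat_r; [apply Rabs_pos|].
    apply Rabs_le, COS_bound.
Qed.

Lemma Rabs_between_0 (c y : R) : Rmin 0 y <= c <= Rmax 0 y -> Rabs c <= Rabs y.
Proof.
  unfold Rmin, Rmax, Rabs. intros H.
  destruct (Rle_dec 0 y), (Rcase_abs c), (Rcase_abs y); lra.
Qed.

(** The mean value theorem gains one power of [Rabs y]: the derivative at the intermediate point [c]
    is itself at most [Rabs c]. The next lemma works in the same way. *)
Lemma cos_sub_1_bound2 (y : R) : Rabs (cos y - 1) <= y ^ 2.
Proof.
  destruct (MVT_gen cos 0 y (fun z => - sin z)) as (c & Hc & H).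
  - intros x _. apply is_derive_cos.
  - intros x _. apply continuity_cos.
  - rewrite cos_0 in H. rewrite H, Rminus_0_r, Rabs_mult, Rabs_Ropp.
    rewrite <- (pow2_abs y). simpl. rewrite Rmult_1_r.
    apply Rmult_le_compat_r; [apply Rabs_pos|].
    eapply Rle_trans; [apply sin_bound_abs | now apply Rabs_between_0].
Qed.

Lemma sin_sub_id_bound (y : R) : Rabs (sin y - y) <= y ^ 2.
Proof.
  destruct (MVT_gen (fun z => sin z - z) 0 y (fun z => cos z - 1)) as (c & Hc & H).
  - intros x _. auto_derive; [trivial | ring].
  - intros x _. apply continuity_pt_minus; [apply continuity_sin | apply continuity_pt_id].
  - rewrite sin_0, !Rminus_0_r in H. rewrite H, Rabs_mult.
    rewrite <- (pow2_abs y). simpl. rewrite Rmult_1_r.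
    apply Rmult_le_compat_r; [apply Rabs_pos|].
    eapply Rle_trans; [apply cos_sub_1_bound | now apply Rabs_between_0].
Qed.

Lemma Cmod_cis_sub_1 (y : R) : Cmod (cis y - 1)%C <= 2 * Rabs y.
Proof.
  eapply Rle_trans; [apply Cmod_le_Re_Im|]. rewrite cis_eq. unfold Re, Im; simpl.
  pose proof (cos_sub_1_bound y). pose proof (sin_bound_abs y).
  replace (cos y + - (1)) with (cos y - 1) by ring.
  replace (sin y + - 0) with (sin y) by ring. lra.
Qed.

Lemma Cmod_cis_sub_linear (y : R) : Cmod (cis y - 1 - Ci * y)%C <= 2 * y ^ 2.
Proof.
  eapply Rle_trans; [apply Cmod_le_Re_Im|]. rewrite cis_eq. unfold Re, Im; simpl.
  pose proof (cos_sub_1_bound2 y) as H1. pose proof (sin_sub_id_bound y) as H2.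
  replace (cos y + - (1) + - (0 * y - 1 * 0)) with (cos y - 1) by ring.
  replace (sin y + - 0 + - (0 * 0 + 1 * y)) with (sin y - y) by ring.
  simpl in *. lra.
Qed.

(** * Stability of Schwartz functions *)

Lemma is_Cderive_id (x : R) : is_Cderive RtoC x (RtoC 1).
Proof. split; [apply @is_derive_id | exact (is_derive_const 0 x)]. Qed.

Lemma is_Cderive_scal (c : C) (f : R -> C) (x : R) (l : C) :
  is_Cderive f x l -> is_Cderive (fun s => c * f s)%C x (c * l)%C.
Proof.
  intros Hf. replace (c * l)%C with (RtoC 0 * f x + c * l)%C by ring.
  apply (is_Cderive_mult (fun _ => c)); [apply is_Cderive_const | exact Hf].
Qed.

Lemma schwartz_cis (t : R) (g : R -> C) :
  schwartz g -> schwartz (fun x => cis (t * x) * g x)%C.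
Proof.
  intros Hg.
  (* The zeroth power makes the multiplier literally the entry of index 0 in its sequence of
     derivatives. *)
  replace (fun x => cis (t * x) * g x)%C
    with (fun x => (Ci * RtoC t) ^ 0 * cis (t * x) * g x)%C
    by (apply functional_extensionality; intro x; simpl; ring).
  apply (schwartz_mult (fun j x => (Ci * RtoC t) ^ j * cis (t * x))%C
           (fun j => Rabs t ^ j)); [| |exact Hg].
  - intros j x.
    replace ((Ci * RtoC t) ^ S j * cis (t * x))%C with
      ((Ci * RtoC t) ^ j * (Ci * RtoC t * cis (t * x)))%C
      by (rewrite Cpow_S; ring).
    apply is_Cderive_scal, is_Cderive_cis.
  - intros j x. rewrite Cmod_mult, Cmod_cis, Cmod_pow, Cmod_mult, Cmod_Ci, Cmod_R.
    rewrite Rmult_1_l, Rmult_1_r. pose proof (pow_le _ j (Rabs_pos t)).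
    pose proof (pow2_ge_0 x). nra.
Qed.

Lemma schwartz_scal (c : C) (g : R -> C) :
  schwartz g -> schwartz (fun x => c * g x)%C.
Proof.
  apply (schwartz_mult (fun j _ => match j with O => c | _ => RtoC 0 end)
           (fun j => Cmod c)).
  - intros [|j] x; [exact (is_Cderive_const c x) | exact (is_Cderive_const 0 x)].
  - intros j x. pose proof (pow2_ge_0 x). pose proof (Cmod_ge_0 c).
    destruct j; [|rewrite Cmod_0]; nra.
Qed.

Lemma Rabs_le_1_plus_sqr (x : R) : Rabs x <= 1 + x ^ 2.
Proof. rewrite <- (pow2_abs x). pose proof (Rabs_pos x). nra. Qed.

(** Each differentiation of e^(itx) in [t] produces the factor [Ci * x], so the derivatives of a
    weak characteristic function again pair [T] with Schwartz functions. *)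
Lemma schwartz_Ci_mult_id (g : R -> C) :
  schwartz g -> schwartz (fun x => Ci * RtoC x * g x)%C.
Proof.
  apply (schwartz_mult
    (fun j x => match j with O => Ci * RtoC x | 1%nat => Ci | _ => RtoC 0 end)%C
    (fun _ => 1)).
  - intros [|[|j]] x.
    + pose proof (is_Cderive_scal Ci _ _ _ (is_Cderive_id x)) as H.
      rewrite Cmult_1_r in H. exact H.
    + exact (is_Cderive_const Ci x).
    + exact (is_Cderive_const 0 x).
  - intros j x. rewrite Rmult_1_l. pose proof (Rabs_le_1_plus_sqr x).
    pose proof (pow2_ge_0 x).
    destruct j as [|[|j]]; rewrite ?Cmod_mult, ?Cmod_Ci, ?Cmod_R, ?Cmod_0;
      rewrite ?Rabs_R0; lra.
Qed.

Lemma schwartz_plus (f g : R -> C) :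
  schwartz f -> schwartz g -> schwartz (fun x => f x + g x)%C.
Proof.
  intros Hf Hg.
  replace (fun x => f x + g x)%C
    with (fun x => CDerive_n f 0 x + CDerive_n g 0 x)%C
    by (apply functional_extensionality; intro x; now rewrite !CDerive_n_0).
  apply (derivative_seq_schwartz (fun m x => CDerive_n f m x + CDerive_n g m x)%C).
  - intros m x. apply is_Cderive_plus; apply Csmooth_derivative_seq;
      [apply Hf | apply Hg].
  - intros k m. destruct (schwartz_rapidly_decreasing f Hf k m) as [B1 H1].
    destruct (schwartz_rapidly_decreasing g Hg k m) as [B2 H2].
    exists (B1 + B2). intros x. specialize (H1 x). specialize (H2 x).
    assert (Hp : 0 <= Rabs x ^ k) by apply pow_le, Rabs_pos.
    pose proof (Rmult_le_compat_l _ _ _ Hp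
      (Cmod_triangle (CDerive_n f m x) (CDerive_n g m x))). lra.
Qed.

(* Successive derivatives in [x] of [(e^(ihx) - 1) / h - ix]: all are O(h (1 + x^2)). *)
Definition cis_quotient_error (h : R) (j : nat) (x : R) : C :=
  match j with
  | O => RtoC (/ h) * (cis (h * x) - 1) + - Ci * RtoC x
  | 1%nat => Ci * (cis (h * x) - 1)
  | S (S j) => (Ci * RtoC h) ^ j * (Ci * (Ci * RtoC h)) * cis (h * x)
  end%C.

Lemma derivative_seq_cis_quotient_error (h : R) :
  h <> 0 -> derivative_seq (cis_quotient_error h).
Proof.
  intros Hh m x.
  assert (Hc : is_Cderive (fun x => cis (h * x) - 1)%C x
                 (Ci * RtoC h * cis (h * x))%C).
  { rewrite <- (Cplus_0_r (Ci * RtoC h * cis (h * x))%C).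
    apply is_Cderive_plus; [apply is_Cderive_cis | apply is_Cderive_const]. }
  destruct m as [|[|m]]; simpl.
  - replace (Ci * (cis (h * x) - 1))%C with
      (RtoC (/ h) * (Ci * RtoC h * cis (h * x)) + - Ci * RtoC 1)%C.
    2: { rewrite RtoC_inv by exact Hh. field.
         intro E. apply Hh. now apply RtoC_inj in E. }
    apply is_Cderive_plus; apply is_Cderive_scal; [exact Hc | apply is_Cderive_id].
  - replace (1 * (Ci * (Ci * RtoC h)) * cis (h * x))%C with
      (Ci * (Ci * RtoC h * cis (h * x)))%C by ring.
    now apply is_Cderive_scal.
  - replace (Ci * RtoC h * (Ci * RtoC h) ^ m * (Ci * (Ci * RtoC h)) * cis (h * x))%C
      with ((Ci * RtoC h) ^ m * (Ci * (Ci * RtoC h)) * (Ci * RtoC h * cis (h * x)))%C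
      by ring.
    apply is_Cderive_scal, is_Cderive_cis.
Qed.

(** Order 0 needs the second-order estimate of e^(iy), one power of [h] being lost to the quotient;
    order 1 needs the first-order one. Higher orders contain a factor [h], and [Rabs h <= 1] absorbs
    its other powers. *)
Lemma cis_quotient_error_bound (h : R) (j : nat) (x : R) :
  h <> 0 -> Rabs h <= 1 ->
  Cmod (cis_quotient_error h j x) <= Rabs h * 2 * (1 + x ^ 2).
Proof.
  intros Hh H1. pose proof (Rabs_pos_lt h Hh) as Hp.
  assert (Hx : 0 <= x ^ 2) by apply pow2_ge_0.
  destruct j as [|[|j]]; simpl cis_quotient_error.
  - replace (RtoC (/ h) * (cis (h * x) - 1) + - Ci * RtoC x)%C
      with (RtoC (/ h) * (cis (h * x) - 1 - Ci * RtoC (h * x)))%C.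
    2: { rewrite RtoC_mult, RtoC_inv by exact Hh. field.
         intro E. apply Hh. now apply RtoC_inj in E. }
    rewrite Cmod_mult, Cmod_R, Rabs_inv.
    apply Rle_trans with (/ Rabs h * (2 * (h * x) ^ 2)).
    + apply Rmult_le_compat_l; [left; now apply Rinv_0_lt_compat|].
      apply Cmod_cis_sub_linear.
    + replace ((h * x) ^ 2) with (Rabs h ^ 2 * x ^ 2)
        by (rewrite pow2_abs; ring).
      replace (/ Rabs h * (2 * (Rabs h ^ 2 * x ^ 2)))
        with (Rabs h * 2 * x ^ 2) by (field; lra).
      nra.
  - rewrite Cmod_mult, Cmod_Ci, Rmult_1_l.
    eapply Rle_trans; [apply Cmod_cis_sub_1|]. rewrite Rabs_mult.
    pose proof (Rabs_le_1_plus_sqr x). nra.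
  - rewrite !Cmod_mult, Cmod_cis, Cmod_pow, Cmod_mult, Cmod_Ci, Cmod_R.
    rewrite !Rmult_1_l, Rmult_1_r.
    assert (Hj : 0 <= Rabs h ^ j <= 1).
    { split; [apply pow_le; lra|]. rewrite <- (pow1 j). apply pow_incr; lra. }
    nra.
Qed.

(** * Differentiation under the distribution *)

(** Continuity of [T] involves only the seminorms of orders up to some [N]; their constants are
    merged by addition, which monotonicity in the constant allows. *)
Lemma uniform_constant (P : nat -> R -> Prop) (N : nat) :
  (forall n c d, P n c -> c <= d -> P n d) ->
  (forall n, exists c, 0 <= c /\ P n c) ->
  exists c, 0 <= c /\ forall n, (n <= N)%nat -> P n c.
Proof.
  intros Hm HP. induction N as [|N (c & Hc & IH)].
  - destruct (HP 0%nat) as (c & Hc & H). exists c. split; [exact Hc|].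
    intros n Hn. now replace n with 0%nat by lia.
  - destruct (HP (S N)) as (d & Hd & H). exists (c + d). split; [lra|].
    intros n Hn. destruct (Nat.eq_dec n (S N)) as [->|].
    + apply Hm with d; [exact H | lra].
    + apply Hm with c; [apply IH; lia | lra].
Qed.

Lemma cis_quotient_seminorm (g : R -> C) (N : nat) :
  schwartz g ->
  exists c, 0 <= c /\ forall k m, (k <= N)%nat -> (m <= N)%nat ->
    forall h, h <> 0 -> Rabs h <= 1 ->
    Rbar_le (schwartz_seminorm k m (fun x => cis_quotient_error h 0 x * g x)%C)
      (Rabs h * c).
Proof.
  intros Hg.
  set (Q := fun k m c => forall h, h <> 0 -> Rabs h <= 1 ->
    Rbar_le (schwartz_seminorm k m (fun x => cis_quotient_error h 0 x * g x)%C)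
      (Rabs h * c)).
  assert (Hmono : forall k m c d, Q k m c -> c <= d -> Q k m d).
  { intros k m c d H Hcd h Hh H1. eapply Rbar_le_trans; [now apply H|].
    simpl. apply Rmult_le_compat_l; [apply Rabs_pos | exact Hcd]. }
  destruct (uniform_constant (fun k c => forall m, (m <= N)%nat -> Q k m c) N)
    as (c & Hc & H).
  - intros k c d H Hcd m Hm. apply Hmono with c; auto.
  - intros k. apply (uniform_constant (Q k) N); [intros n; apply Hmono|].
    intros m.
    destruct (leibniz_bound m k (fun _ => 2) _ (schwartz_rapidly_decreasing g Hg))
      as (c & Hc & H).
    exists c. split; [exact Hc|]. intros h Hh H1.
    apply schwartz_seminorm_le. intros x.
    replace (fun x => cis_quotient_error h 0 x * g x)%C
      with (leibniz 0 (cis_quotient_error h) (CDerive_n g)).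
    2: { apply functional_extensionality; intro y. simpl. now rewrite CDerive_n_0. }
    rewrite (CDerive_n_derivative_seq
      (fun m => leibniz m (cis_quotient_error h) (CDerive_n g))).
    (* [leibniz_bound] is used with [w = Rabs h]; as its constant is uniform in the multiplier, [c]
       does not depend on [h]. *)
    + apply H; [apply Rabs_pos|].
      intros j y. now apply cis_quotient_error_bound.
    + apply derivative_seq_leibniz;
        [now apply derivative_seq_cis_quotient_error
        |now apply Csmooth_derivative_seq, Hg].
  - exists c. split; [exact Hc|]. intros k m Hk Hm. exact (H k Hk m Hm).
Qed.

(** By linearity the difference quotient is [T q], where [q] differs from [Ci * x * g] by
    [cis_quotient_error h 0 * g]. The seminorms of that product are O(h), so continuity of [T] at
    [Ci * x * g] applies. *)
Lemma tempered_cis_quotient (T : (R -> C) -> C) (g : R -> C) (eps : R) :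
  tempered T -> schwartz g -> 0 < eps ->
  exists d, 0 < d /\ forall h, h <> 0 -> Rabs h < d ->
    Cmod (RtoC (/ h) * (T (fun x => cis (h * x) * g x) - T g)
          - T (fun x => Ci * RtoC x * g x))%C < eps.
Proof.
  intros (Hadd & Hscal & Hcont) Hg Heps.
  destruct (Hcont _ (schwartz_Ci_mult_id g Hg) eps Heps) as (N & delta & Hd & HN).
  destruct (cis_quotient_seminorm g N Hg) as (c & Hc & Hsem).
  (* The 1 secures [Rabs h <= 1] for the seminorm bound; [c + 1] is positive even when [c = 0]. *)
  exists (Rmin 1 (delta / (c + 1))).
  assert (Hq : 0 < delta / (c + 1)) by (apply Rdiv_lt_0_compat; lra).
  split; [apply Rmin_glb_lt; lra|].
  intros h Hh Hhd.
  pose proof (Rmin_l 1 (delta / (c + 1))). pose proof (Rmin_r 1 (delta / (c + 1))).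
  set (q := fun x => (RtoC (/ h) * (cis (h * x) * g x + - RtoC 1 * g x))%C).
  assert (Hs : schwartz (fun x => cis (h * x) * g x + - RtoC 1 * g x)%C)
    by (apply schwartz_plus; [apply schwartz_cis | apply schwartz_scal]; exact Hg).
  replace (RtoC (/ h) * (T (fun x => cis (h * x) * g x) - T g))%C with (T q).
  - apply HN; [now apply schwartz_scal|]. intros k m Hk Hm.
    replace (fun x => q x - Ci * RtoC x * g x)%C
      with (fun x => cis_quotient_error h 0 x * g x)%C.
    2: { apply functional_extensionality; intro x.
         unfold q, cis_quotient_error. ring. }
    eapply Rbar_le_lt_trans; [apply Hsem; trivial; lra|]. simpl.
    apply Rle_lt_trans with (Rabs h * (c + 1)).
    + apply Rmult_le_compat_l; [apply Rabs_pos | lra].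
    + replace delta with (delta / (c + 1) * (c + 1)) by (field; lra).
      apply Rmult_lt_compat_r; lra.
  - unfold q. rewrite (Hscal _ _ Hs).
    rewrite (Hadd (fun x => cis (h * x) * g x)%C (fun x => - RtoC 1 * g x)%C
               (schwartz_cis h g Hg) (schwartz_scal _ g Hg)).
    rewrite (Hscal _ g Hg). ring.
Qed.

(** Since e^(i(t+h)x) = e^(ihx) e^(itx), the derivative at [t] is the previous lemma applied to
    e^(itx) g. The derivative is again a weak characteristic function, so the lemma can be
    iterated. *)
Lemma is_Cderive_weak_cf (T : (R -> C) -> C) (g : R -> C) (t : R) :
  tempered T -> schwartz g ->
  is_Cderive (weak_cf T g) t (weak_cf T (fun x => Ci * RtoC x * g x)%C t).
Proof.
  intros HT Hg.
  assert (H : forall eps, 0 < eps -> exists d : posreal, forall h, h <> 0 ->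
    Rabs h < d -> Cmod (RtoC (/ h) * (weak_cf T g (t + h) - weak_cf T g t)
      - weak_cf T (fun x => Ci * RtoC x * g x) t)%C < eps).
  { intros eps Heps.
    destruct (tempered_cis_quotient T _ eps HT (schwartz_cis t g Hg) Heps)
      as (d & Hd & H).
    exists (mkposreal d Hd). intros h Hh Hhd. specialize (H h Hh Hhd).
    unfold weak_cf, weak_cf_of. fold cis.
    replace (fun v => Cexp (Ci * RtoC ((t + h) * v)) * g v)%C
      with (fun x => cis (h * x) * (cis (t * x) * g x))%C.
    2: { apply functional_extensionality; intro x. fold (cis ((t + h) * x)).
         rewrite Rmult_plus_distr_r, cis_plus. ring. }
    replace (fun v => Cexp (Ci * RtoC (t * v)) * (Ci * RtoC v * g v))%C
      with (fun x => Ci * RtoC x * (cis (t * x) * g x))%C.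
    2: { apply functional_extensionality; intro x. unfold cis. ring. }
    exact H. }
  split; apply is_derive_Reals; intros eps Heps;
    destruct (H eps Heps) as [d Hd]; exists d; intros h Hh Hhd;
    specialize (Hd h Hh Hhd);
    (eapply Rle_lt_trans; [|exact Hd]); (eapply Rle_trans; [|apply Rmax_Cmod]).
  - eapply Rle_trans; [|apply Rmax_l]. right. f_equal.
    unfold Re, Im, Cminus, Cmult; simpl. field. exact Hh.
  - eapply Rle_trans; [|apply Rmax_r]. right. f_equal.
    unfold Re, Im, Cminus, Cmult; simpl. field. exact Hh.
Qed.

(** * The logarithm near the origin *)

(** Only differentiability of [f1] at 0 itself is assumed, hence the Peano form of the remainder.
    The mean value theorem applied to the remainder leaves [f1 c - f1 0 - l2 * c], which is o(c),
    times [s]. *)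
Lemma taylor_young_2 (f f1 : R -> R) (eps : R) :
  locally 0 (fun s => is_derive f s (f1 s)) -> ex_derive f1 0 -> 0 < eps ->
  locally 0 (fun s => Rabs (f s - f 0 - Derive_n f 1 0 * s
                            - Derive_n f 2 0 / 2 * s ^ 2) <= eps * s ^ 2).
Proof.
  intros Hf [l2 Hl2] Heps.
  assert (E1 : Derive_n f 1 0 = f1 0)
    by (apply is_derive_unique; exact (locally_singleton _ _ Hf)).
  assert (E2 : Derive_n f 2 0 = l2).
  { change (Derive (Derive f) 0 = l2). rewrite (Derive_ext_loc _ f1).
    - now apply is_derive_unique.
    - revert Hf. apply filter_imp. intros s Hs. now apply is_derive_unique. }
  rewrite E1, E2.
  destruct Hf as [d1 Hf]. apply is_derive_Reals in Hl2.
  destruct (Hl2 eps Heps) as [d2 H2].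
  exists (mkposreal _ (Rmin_stable_in_posreal d1 d2)). intros s Hs.
  assert (Hs' : Rabs s < Rmin d1 d2).
  { replace s with (minus s 0); [exact Hs|]. unfold minus, plus, opp; simpl; ring. }
  clear Hs. pose proof (Rmin_l d1 d2). pose proof (Rmin_r d1 d2).
  assert (Hg : forall y, Rabs y < d1 ->
    is_derive (fun y => f y - f1 0 * y - l2 / 2 * y ^ 2) y (f1 y - f1 0 - l2 * y)).
  { intros y Hy.
    assert (Hfy : is_derive f y (f1 y)).
    { apply Hf. change (Rabs (minus y 0) < d1).
      replace (minus y 0) with y; [exact Hy|]. unfold minus, plus, opp; simpl; ring. }
    auto_derive; [exists (f1 y); exact Hfy|].
    replace (Derive (fun x => f x) y) with (f1 y) by (symmetry; now apply is_derive_unique).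
    field. }
  destruct (MVT_gen (fun y => f y - f1 0 * y - l2 / 2 * y ^ 2) 0 s
              (fun y => f1 y - f1 0 - l2 * y)) as (c & Hc & Hmvt).
  - intros y Hy. apply Hg. apply Rle_lt_trans with (Rabs s); [|lra].
    apply Rabs_between_0; split; apply Rlt_le; apply Hy.
  - intros y Hy. apply continuity_pt_filterlim.
    apply (ex_derive_continuous (fun y => f y - f1 0 * y - l2 / 2 * y ^ 2)).
    eexists. apply Hg. apply Rle_lt_trans with (Rabs s); [|lra].
    now apply Rabs_between_0.
  - apply Rabs_between_0 in Hc.
    replace (f s - f 0 - f1 0 * s - l2 / 2 * s ^ 2)
      with ((f1 c - f1 0 - l2 * c) * s).
    2: { transitivity ((f1 c - f1 0 - l2 * c) * (s - 0)); [ring|].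
         rewrite <- Hmvt. ring. }
    rewrite Rabs_mult, <- (pow2_abs s).
    assert (Hb : Rabs (f1 c - f1 0 - l2 * c) <= eps * Rabs c).
    (* The difference quotient of [f1] says nothing at [c = 0], where both sides vanish. *)
    { destruct (Req_dec c 0) as [->|Hc0].
      - rewrite Rabs_R0. replace (f1 0 - f1 0 - l2 * 0) with 0 by ring.
        rewrite Rabs_R0. lra.
      - specialize (H2 c Hc0). rewrite Rplus_0_l in H2.
        replace (f1 c - f1 0 - l2 * c) with (((f1 c - f1 0) / c - l2) * c)
          by (field; exact Hc0).
        rewrite Rabs_mult. apply Rmult_le_compat_r; [apply Rabs_pos|].
        left. apply H2. lra. }
    pose proof (Rabs_pos s) as Hs0.
    apply Rle_trans with (eps * Rabs s * Rabs s); [|right; ring].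
    apply Rmult_le_compat_r; [exact Hs0|]. eapply Rle_trans; [exact Hb|].
    apply Rmult_le_compat_l; lra.
Qed.

Lemma Cexp_plus (z w : C) : Cexp (z + w)%C = (Cexp z * Cexp w)%C.
Proof.
  unfold Cexp. destruct z as [a b], w as [c d]. simpl.
  rewrite exp_plus, cos_plus, sin_plus.
  unfold Cmult, RtoC; simpl. f_equal; ring.
Qed.

Lemma Cexp_pow (z : C) (n : nat) : (Cexp z ^ n)%C = Cexp (RtoC (INR n) * z)%C.
Proof.
  induction n as [|n IH].
  - simpl. replace (RtoC 0 * z)%C with (Ci * RtoC 0)%C by ring.
    symmetry. apply cis_0.
  - rewrite Cpow_S, IH, <- Cexp_plus, S_INR, RtoC_plus. f_equal. ring.
Qed.

Lemma Cexp_eq (z : C) :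
  Cexp z = (exp (Re z) * cos (Im z), exp (Re z) * sin (Im z)).
Proof. unfold Cexp, RtoC, Cmult; simpl. f_equal; ring. Qed.

(** Continuity and [K 0 = 0] keep the imaginary part of [K] within PI/2 of 0, where [atan] inverts
    [tan]; this removes the ambiguity by multiples of 2 PI. The real part comes from the squared
    modulus of [f], which is exp (2 Re K). *)
Lemma is_log_branch_Re_Im (f K : R -> C) :
  f 0 = RtoC 1 -> continuous (fun s => Re (f s)) 0 -> is_log_branch f K ->
  locally 0 (fun s => 0 < Re (f s) /\
    Re (K s) = ln (Re (f s) ^ 2 + Im (f s) ^ 2) / 2 /\
    Im (K s) = atan (Im (f s) / Re (f s))).
Proof.
  intros Hf0 Hc [HK0 HK].
  assert (HcK : continuous (fun s => Im (K s)) 0).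
  { apply (continuous_comp K Im); [apply (locally_singleton _ _ HK)|].
    unfold Im. apply (continuous_snd (fst (K 0)) (snd (K 0))). }
  assert (Hu : locally 0 (fun s => 0 < Re (f s))).
  { apply (Hc (fun y => 0 < y)). apply (open_gt 0). rewrite Hf0. simpl. lra. }
  assert (Hb : locally 0 (fun s => Rabs (Im (K s)) < PI / 2)).
  { apply (HcK (fun y => Rabs y < PI / 2)).
    apply (continuous_Rabs _ (fun y => y < PI / 2)).
    apply (open_lt (PI / 2)). rewrite HK0. simpl. rewrite Rabs_R0.
    pose proof PI_RGT_0. lra. }
  generalize (filter_and _ _ (filter_and _ _ Hu Hb) HK).
  apply filter_imp. intros s [[Hus Hbs] [_ Hs]].
  split; [exact Hus|]. rewrite <- Hs, Cexp_eq. simpl.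
  apply Rabs_def2 in Hbs. pose proof (exp_pos (Re (K s))) as He.
  split.
  - replace (exp (Re (K s)) * cos (Im (K s)) * (exp (Re (K s)) * cos (Im (K s)) * 1)
       + exp (Re (K s)) * sin (Im (K s)) * (exp (Re (K s)) * sin (Im (K s)) * 1))
      with (exp (Re (K s) + Re (K s))).
    + rewrite ln_exp. field.
    + rewrite exp_plus. pose proof (sin2_cos2 (Im (K s))) as H. unfold Rsqr in H.
      transitivity (exp (Re (K s)) * exp (Re (K s)) *
        (sin (Im (K s)) * sin (Im (K s)) + cos (Im (K s)) * cos (Im (K s))));
        [rewrite H; ring | ring].
  - rewrite <- (atan_tan (Im (K s))) at 1 by lra. f_equal. unfold tan. field.
    split; [apply Rgt_not_eq, cos_gt_0; lra | lra].
Qed.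

(** For f = u + iv, the derivatives here and in the next lemma are the real and imaginary parts of
    f'/f. *)
Lemma is_derive_ln_modulus (u v : R -> R) (u' v' s : R) :
  is_derive u s u' -> is_derive v s v' -> 0 < u s ->
  is_derive (fun s => ln (u s ^ 2 + v s ^ 2) / 2) s
    ((u s * u' + v s * v') / (u s ^ 2 + v s ^ 2)).
Proof.
  intros Hu Hv Hpos.
  assert (H : 0 < u s ^ 2 + v s ^ 2)
    by (pose proof (pow_lt _ 2 Hpos); pose proof (pow2_ge_0 (v s)); lra).
  auto_derive.
  - repeat split; [now exists u' | now exists v' | exact H].
  - replace (Derive (fun x => u x) s) with u' by (symmetry; now apply is_derive_unique).
    replace (Derive (fun x => v x) s) with v' by (symmetry; now apply is_derive_unique).
    field. lra.
Qed.

Lemma is_derive_atan_quotient (u v : R -> R) (u' v' s : R) :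
  is_derive u s u' -> is_derive v s v' -> 0 < u s ->
  is_derive (fun s => atan (v s / u s)) s
    ((v' * u s - v s * u') / (u s ^ 2 + v s ^ 2)).
Proof.
  intros Hu Hv Hpos.
  assert (H : 0 < u s ^ 2 + v s ^ 2)
    by (pose proof (pow_lt _ 2 Hpos); pose proof (pow2_ge_0 (v s)); lra).
  auto_derive.
  - repeat split; [now exists v' | now exists u' | lra].
  - replace (Derive (fun x => u x) s) with u' by (symmetry; now apply is_derive_unique).
    replace (Derive (fun x => v x) s) with v' by (symmetry; now apply is_derive_unique).
    field. split; [lra|]. unfold Rsqr. nra.
Qed.

(** With [w1], [w2] the derivatives of [u], [v], this makes the logarithm twice differentiable. *)
Lemma ex_derive_quotient_modulus (u v w1 w2 : R -> R) (s : R) :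
  ex_derive u s -> ex_derive v s -> ex_derive w1 s -> ex_derive w2 s -> 0 < u s ->
  ex_derive (fun s => (u s * w1 s + v s * w2 s) / (u s ^ 2 + v s ^ 2)) s /\
  ex_derive (fun s => (w2 s * u s - v s * w1 s) / (u s ^ 2 + v s ^ 2)) s.
Proof.
  intros Hu Hv H1 H2 Hpos.
  assert (H : 0 < u s ^ 2 + v s ^ 2)
    by (pose proof (pow_lt _ 2 Hpos); pose proof (pow2_ge_0 (v s)); lra).
  split; auto_derive; repeat split; trivial; apply Rgt_not_eq; exact H.
Qed.

Lemma is_log_branch_derive (f f1 f2 K : R -> C) :
  f 0 = RtoC 1 -> (forall s, is_Cderive f s (f1 s)) ->
  (forall s, is_Cderive f1 s (f2 s)) -> is_log_branch f K ->
  (exists a1, locally 0 (fun s => is_derive (fun s => Re (K s)) s (a1 s)) /\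
              ex_derive a1 0) /\
  (exists b1, locally 0 (fun s => is_derive (fun s => Im (K s)) s (b1 s)) /\
              ex_derive b1 0).
Proof.
  intros Hf0 Hf Hf1 HK.
  assert (Hc : continuous (fun s => Re (f s)) 0).
  { apply (ex_derive_continuous (fun s => Re (f s))).
    eexists. exact (proj1 (Hf 0)). }
  pose proof (is_log_branch_Re_Im f K Hf0 Hc HK) as Hloc.
  (* Differentiating at a nearby [s] requires the formulas for [K] on a whole neighbourhood of that
     [s]. *)
  apply locally_locally in Hloc.
  destruct (ex_derive_quotient_modulus (fun s => Re (f s)) (fun s => Im (f s))
    (fun s => Re (f1 s)) (fun s => Im (f1 s)) 0) as [Ha Hb].
  { eexists. exact (proj1 (Hf 0)). }
  { eexists. exact (proj2 (Hf 0)). }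
  { eexists. exact (proj1 (Hf1 0)). }
  { eexists. exact (proj2 (Hf1 0)). }
  { rewrite Hf0. simpl. lra. }
  split; [exists (fun s => (Re (f s) * Re (f1 s) + Im (f s) * Im (f1 s)) /
      (Re (f s) ^ 2 + Im (f s) ^ 2)); split; [|exact Ha]
    |eexists; split; [|exact Hb]]; revert Hloc; apply filter_imp;
    intros s Hs; pose proof (proj1 (locally_singleton _ _ Hs)) as Hus.
  - apply (is_derive_ext_loc (fun s => ln (Re (f s) ^ 2 + Im (f s) ^ 2) / 2)).
    { revert Hs. apply filter_imp. intros y Hy. symmetry. apply Hy. }
    exact (is_derive_ln_modulus _ _ _ _ s (proj1 (Hf s)) (proj2 (Hf s)) Hus).
  - apply (is_derive_ext_loc (fun s => atan (Im (f s) / Re (f s)))).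
    { revert Hs. apply filter_imp. intros y Hy. symmetry. apply Hy. }
    exact (is_derive_atan_quotient _ _ _ _ s (proj1 (Hf s)) (proj2 (Hf s)) Hus).
Qed.

(** * The normalised sums *)

(** The scalar [c] makes the induction work: once the outer variable [x] is fixed, its factor
    [cis (s * x) * phi x] joins the scalar of the inner functional. It later also carries the
    centring factor of Z_n. *)
Lemma tensor_pow_cis (T : (R -> C) -> C) (phi : R -> C) (s : R) (n : nat) (c : C) :
  tempered T -> schwartz phi ->
  tensor_pow T n (fun v => c * cis (s * Tn_sum n v) * fun_tensor_pow phi n v)%C
    = (c * weak_cf T phi s ^ n)%C.
Proof.
  intros (_ & Hscal & _) Hphi. revert c. induction n as [|n IH]; intros c; simpl.
  - rewrite Rmult_0_r, cis_0. ring.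
  - transitivity (T (fun x => (c * weak_cf T phi s ^ n) * (cis (s * x) * phi x))%C).
    + f_equal. apply functional_extensionality; intro x.
      transitivity ((c * cis (s * x) * phi x) * weak_cf T phi s ^ n)%C; [|ring].
      rewrite <- IH. f_equal. apply functional_extensionality; intro y.
      rewrite Rmult_plus_distr_l, cis_plus. ring.
    + rewrite (Hscal _ _ (schwartz_cis s phi Hphi)).
      change (T (fun x => cis (s * x) * phi x)%C) with (weak_cf T phi s). ring.
Qed.

Lemma weak_cf_Z_eq (T : (R -> C) -> C) (phi : R -> C) (k1 k2 t : R) (n : nat) :
  tempered T -> schwartz phi ->
  let s := t / sqrt (INR n * k2) in
  weak_cf_Z T phi k1 k2 n t = (cis (- (INR n * k1 * s)) * weak_cf T phi s ^ n)%C.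
Proof.
  intros HT Hphi s. rewrite <- tensor_pow_cis by assumption.
  unfold weak_cf_Z, weak_cf_of. f_equal. apply functional_extensionality; intro v.
  rewrite <- cis_plus. unfold cis. do 4 f_equal. unfold s, Rdiv. ring.
Qed.

Lemma is_lim_seq_inv_sqrt (k2 t : R) :
  0 < k2 -> is_lim_seq (fun n => t / sqrt (INR n * k2)) 0.
Proof.
  intros Hk2. rewrite <- (Rmult_0_r t). unfold Rdiv.
  apply (is_lim_seq_scal_l _ t 0).
  apply (is_lim_seq_inv (fun n => sqrt (INR n * k2)) p_infty); [|easy].
  apply (filterlim_comp _ _ _ (fun n => INR n * k2) sqrt _ (Rbar_locally p_infty));
    [|apply filterlim_sqrt_p].
  apply (is_lim_seq_mult INR (fun _ => k2) p_infty k2).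
  - apply is_lim_seq_INR.
  - apply is_lim_seq_const.
  - simpl. unfold is_Rbar_mult, Rbar_mult'. destruct (Rle_dec 0 k2); [|lra].
    destruct (Rle_lt_or_eq_dec 0 k2 r); [easy | lra].
Qed.

(** With s_n = t / sqrt (n k2), the product n s_n^2 is the constant t^2 / k2 for positive n, so n
    times an o(s_n^2) tends to 0. *)
Lemma is_lim_seq_little_o_sqr (r : R -> R) (k2 t : R) :
  0 < k2 -> (forall eps, 0 < eps -> locally 0 (fun s => Rabs (r s) <= eps * s ^ 2)) ->
  is_lim_seq (fun n => INR n * r (t / sqrt (INR n * k2))) 0.
Proof.
  intros Hk2 Hr. apply is_lim_seq_spec. intros eps.
  assert (Hq : 0 <= t ^ 2 / k2).
  { apply Rmult_le_pos; [apply pow2_ge_0 | left; now apply Rinv_0_lt_compat]. }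
  (* The added 1 keeps the denominator positive when [t = 0] and makes the final bound strict. *)
  set (e := eps / (t ^ 2 / k2 + 1)).
  assert (He : 0 < e) by (apply Rdiv_lt_0_compat; [apply cond_pos | lra]).
  assert (H1 : eventually (fun n => (1 <= n)%nat)) by now exists 1%nat.
  generalize (filter_and _ _ H1 (is_lim_seq_inv_sqrt k2 t Hk2 _ (Hr e He))).
  apply filter_imp. intros n [Hn H].
  rewrite Rminus_0_r, Rabs_mult, (Rabs_pos_eq (INR n)) by apply pos_INR.
  assert (Hn0 : 0 < INR n) by (apply lt_0_INR; lia).
  apply Rle_lt_trans with (INR n * (e * (t / sqrt (INR n * k2)) ^ 2)).
  - apply Rmult_le_compat_l; [lra | exact H].
  - unfold Rdiv at 1. rewrite Rpow_mult_distr, pow_inv, pow2_sqrt by nra.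
    replace (INR n * (e * (t ^ 2 * / (INR n * k2)))) with (e * (t ^ 2 / k2))
      by (field; lra).
    apply Rlt_le_trans with (e * (t ^ 2 / k2 + 1)); [nra|].
    right. unfold e. field. split; [lra|]. pose proof (pow2_ge_0 t). nra.
Qed.

Lemma filterlim_Cexp (p q : nat -> R) (a b : R) :
  is_lim_seq p a -> is_lim_seq q b ->
  filterlim (fun n => Cexp (p n, q n)) eventually (locally (Cexp (a, b))).
Proof.
  intros Hp Hq.
  apply (filterlim_ext (fun n => (exp (p n) * cos (q n), exp (p n) * sin (q n)))).
  { intros n. now rewrite Cexp_eq. }
  rewrite Cexp_eq. cbn [Re Im fst snd].
  assert (He : is_lim_seq (fun n => exp (p n)) (exp a))
    by (apply is_lim_seq_continuous; [apply derivable_continuous_pt, derivable_pt_exp | exact Hp]).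
  assert (Hc : is_lim_seq (fun n => cos (q n)) (cos b))
    by (apply is_lim_seq_continuous; [apply continuity_cos | exact Hq]).
  assert (Hs : is_lim_seq (fun n => sin (q n)) (sin b))
    by (apply is_lim_seq_continuous; [apply continuity_sin | exact Hq]).
  assert (H1 := is_lim_seq_mult' _ _ _ _ He Hc).
  assert (H2 := is_lim_seq_mult' _ _ _ _ He Hs).
  apply filterlim_locally. intros eps.
  generalize (filter_and _ _ (proj1 (filterlim_locally _ _) H1 eps)
                             (proj1 (filterlim_locally _ _) H2 eps)).
  apply filter_imp. intros n [A B]. split; assumption.
Qed.

Lemma Ci_neq_0 : Ci <> RtoC 0.
Proof. intros E. injection E. exact R1_neq_R0. Qed.

Theorem theorem8p1 (T : (R -> C) -> C) (phi : R -> C) (K : R -> C) (k1 k2 : R)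
    (hT : tempered T) (hphi : schwartz phi) (hnorm : T phi = RtoC 1)
    (hK : is_log_branch (weak_cf T phi) K)
    (hk1 : weak_cumulant K 1 = RtoC k1)
    (hk2 : weak_cumulant K 2 = RtoC k2) (hk2pos : (0 < k2)%R) :
  forall t : R,
    filterlim (fun n : nat => weak_cf_Z T phi k1 k2 n t) eventually
      (locally (RtoC (exp (- (t ^ 2) / 2)))).
Proof.
  intros t.
  assert (H0 : weak_cf T phi 0 = RtoC 1).
  { rewrite <- hnorm. unfold weak_cf, weak_cf_of. f_equal.
    apply functional_extensionality; intro x. fold (cis (0 * x)).
    rewrite Rmult_0_l, cis_0. ring. }
  pose proof (schwartz_Ci_mult_id phi hphi) as hphi1.
  (* The first two derivatives come from multiplying [phi] by [Ci * x] once and twice. *)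
  destruct (is_log_branch_derive (weak_cf T phi)
    (weak_cf T (fun x => Ci * RtoC x * phi x)%C)
    (weak_cf T (fun x => Ci * RtoC x * (Ci * RtoC x * phi x))%C) K H0)
    as [(a1 & Ha & Ha1) (b1 & Hb & Hb1)].
  { intros s. now apply is_Cderive_weak_cf. }
  { intros s. now apply is_Cderive_weak_cf. }
  { exact hK. }
  (* Undoing the powers of [Ci] gives K'(0) = i k1 and K''(0) = - k2. As both cumulants are real,
     the real part of [K] has no linear term and the imaginary part no quadratic one. *)
  assert (D1 : CDerive_n K 1 0 = (0, k1)).
  { replace (CDerive_n K 1 0) with (Ci * weak_cumulant K 1)%C.
    - rewrite hk1. unfold Ci, RtoC, Cmult; simpl. f_equal; ring.
    - unfold weak_cumulant. rewrite Cpow_1_r, Cmult_assoc, Cinv_r, Cmult_1_l;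
        [reflexivity | exact Ci_neq_0]. }
  assert (D2 : CDerive_n K 2 0 = (- k2, 0)).
  { replace (CDerive_n K 2 0) with (Ci ^ 2 * weak_cumulant K 2)%C.
    - rewrite hk2. unfold Ci, RtoC, Cmult; simpl. f_equal; ring.
    - unfold weak_cumulant. rewrite Cmult_assoc, Cinv_r, Cmult_1_l;
        [reflexivity | apply Cpow_nz, Ci_neq_0]. }
  assert (Da1 : Derive_n (fun s => Re (K s)) 1 0 = 0) by exact (f_equal Re D1).
  assert (Db1 : Derive_n (fun s => Im (K s)) 1 0 = k1) by exact (f_equal Im D1).
  assert (Da2 : Derive_n (fun s => Re (K s)) 2 0 = - k2) by exact (f_equal Re D2).
  assert (Db2 : Derive_n (fun s => Im (K s)) 2 0 = 0) by exact (f_equal Im D2).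
  pose proof (proj1 hK) as HK0.
  set (s := fun n => t / sqrt (INR n * k2)).
  assert (La : is_lim_seq (fun n => INR n * (Re (K (s n)) + k2 / 2 * s n ^ 2)) 0).
  { apply (is_lim_seq_little_o_sqr (fun s => Re (K s) + k2 / 2 * s ^ 2) k2 t hk2pos).
    intros eps Heps. generalize (taylor_young_2 (fun s => Re (K s)) a1 eps Ha Ha1 Heps).
    apply filter_imp. intros y Hy.
    rewrite Da1, Da2, HK0 in Hy. simpl Re in Hy.
    replace (Re (K y) + k2 / 2 * y ^ 2)
      with (Re (K y) - 0 - 0 * y - - k2 / 2 * y ^ 2) by field. exact Hy. }
  assert (Lb : is_lim_seq (fun n => INR n * (Im (K (s n)) - k1 * s n)) 0).
  { apply (is_lim_seq_little_o_sqr (fun s => Im (K s) - k1 * s) k2 t hk2pos).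
    intros eps Heps. generalize (taylor_young_2 (fun s => Im (K s)) b1 eps Hb Hb1 Heps).
    apply filter_imp. intros y Hy.
    rewrite Db1, Db2, HK0 in Hy. simpl Im in Hy.
    replace (Im (K y) - k1 * y)
      with (Im (K y) - 0 - k1 * y - 0 / 2 * y ^ 2) by field. exact Hy. }
  (* The real exponent is split as the vanishing remainder [La] plus the constant - t^2 / 2; the
     imaginary exponent is the remainder [Lb]. *)
  replace (RtoC (exp (- t ^ 2 / 2))) with (Cexp (0 + - t ^ 2 / 2, 0)).
  2: { rewrite Cexp_eq. cbn [Re Im fst snd]. rewrite Rplus_0_l, cos_0, sin_0.
       unfold RtoC. f_equal; ring. }
  eapply filterlim_ext_loc; [|apply filterlim_Cexp;
    [exact (is_lim_seq_plus' _ _ _ _ La (is_lim_seq_const (- t ^ 2 / 2)))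
    |exact Lb]].
  assert (H1 : eventually (fun n => (1 <= n)%nat)) by now exists 1%nat.
  (* The exponential formula holds only eventually: [s n] must lie where [K] is a logarithm, and
     [1 <= n] makes [INR n * k2] positive. *)
  generalize (filter_and _ _ H1 (is_lim_seq_inv_sqrt k2 t hk2pos _ (proj2 hK))).
  apply filter_imp. intros n [Hn [_ Hexp]]. fold (s n) in Hexp.
  assert (Hn0 : 0 < INR n) by (apply lt_0_INR; lia).
  rewrite weak_cf_Z_eq by assumption. fold (s n).
  rewrite <- Hexp, Cexp_pow. unfold cis. rewrite <- Cexp_plus. f_equal.
  assert (Hs2 : s n ^ 2 = t ^ 2 / (INR n * k2)).
  { unfold s, Rdiv. rewrite Rpow_mult_distr, pow_inv, pow2_sqrt by nra. ring. }
  rewrite Hs2. destruct (K (s n)) as [x y].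
  unfold Ci, RtoC, Cmult, Cplus; simpl. f_equal; field; lra.
Qed.
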